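(* Let $X$ be a complex Banach space and let $A:D(A)\subset X\to X$ be the generator of a uniformly exponentially stable $C_0$-semigroup $(e^{tA})_{t\ge0}$ on $X$ belonging to the Crandall-Pazy class with parameter $\alpha\in(0,1]$. Let $B:D(B)\subset X\to X$ be a linear operator such that $B$ is $\theta$-subordinate to $A$ with $0<\theta<\alpha\le1$, and $Be^{tA}$ is compact on $X$ for all $t>0$. Assume that $A+B$ generates a strongly continuous semigroup $(e^{t(A+B)})_{t\ge0}$ on $X$. If $(e^{t(A+B)})_{t\ge0}$ is strongly stable, then it is uniformly exponentially stable.
   Context: A $C_0$-semigroup $(T(t))_{t\ge0}$ on $X$ with generator $A$ is in the Crandall-Pazy class with parameter $\alpha\in(0,1]$ if it is immediately differentiable (i.e. $t\mapsto T(t)x$ is differentiable on $(0,\infty)$ for every $x\in X$; equivalently $T(t)X\subset D(A)$ for all $t>0$) and $\|AT(t)\|_{\mathcal L(X)}=O(t^{-1/\alpha})$ as $t\to0^+$. A linear operator $B:D(B)\to X$ is $\theta$-subordinate to $A$ (with $0\le\theta<1$) if $D(A)\subseteq D(B)$ and there is a constant $c>0$ such that $\|Bx\|\le c\,\|Ax\|^{\theta}\|x\|^{1-\theta}$ for all $x\in D(A)$. The operator $A+B$ has domain $D(A+B)=D(A)$. A $C_0$-semigroup $(T(t))_{t\ge0}$ is strongly stable if $\lim_{t\to\infty}\|T(t)x\|=0$ for all $x\in X$, and uniformly exponentially stable if there are $M\ge1$, $\omega>0$ with $\|T(t)\|_{\mathcal L(X)}\le Me^{-\omega t}$ for all $t\ge0$.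 *)

(* Defs.v *)
(* MathComp-Analysis.  A complex Banach space is a
   [completeNormedModType R[i]] with [R : realType]. *)
From HB Require Import structures.
From mathcomp Require Import all_boot all_order all_algebra.
From mathcomp Require Import all_classical all_reals all_analysis.
From mathcomp Require Import complex.

Set Implicit Arguments.
Unset Strict Implicit.
Unset Printing Implicit Defensive.

Import Order.TTheory GRing.Theory Num.Theory.
Import numFieldNormedType.Exports.

Local Open Scope classical_set_scope.
Local Open Scope ring_scope.
Local Open Scope complex_scope.

(* On a normed module over R[i], the library norm [`|x|] lives in R[i], where
   it is a nonnegative real; [rnorm x] is the same number in R. *)
Definition rnorm (R : realType) (X : normedModType R[i]) (x : X) : R :=
  complex.Re `|x|.

(* Extended-real-valued, so that an upper bound on [opnorm f] does assert
   that f is bounded. *)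
Definition opnorm (R : realType) (X : normedModType R[i]) (f : X -> X) : \bar R :=
  ereal_sup [set (rnorm (f x))%:E | x in [set x : X | rnorm x <= 1]].

(* For f linear on all of X. *)
Definition compact_operator (R : realType) (X : normedModType R[i])
    (f : X -> X) : Prop :=
  precompact (f @` [set x : X | rnorm x <= 1]).

(* A linear operator D(A) -> X, where D(A) is a linear subspace of X.  The
   values of [app] outside [dom] are irrelevant. *)
Record operator (R : realType) (X : normedModType R[i]) := Operator {
  dom : set X;
  app :> X -> X;
  dom0 : dom 0;
  domP : forall (a : R[i]) (x y : X), dom x -> dom y -> dom (a *: x + y);
  appP : forall (a : R[i]) (x y : X), dom x -> dom y ->
    app (a *: x + y) = a *: app x + app y }.

(* Semigroups are indexed by R; only the values at t >= 0 matter. *)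
Record C0_semigroup (R : realType) (X : normedModType R[i])
    (T : R -> X -> X) : Prop := {
  sg_linear : forall t, 0 <= t -> linear (T t);
  sg_continuous : forall t, 0 <= t -> continuous (T t);
  sg0 : forall x, T 0 x = x;
  sgD : forall s t x, 0 <= s -> 0 <= t -> T (s + t) x = T s (T t x);
  sg_cvg : forall x, T t x @[t --> 0^'+] --> x }.

(* T is a C0-semigroup with generator A. *)
Definition generates (R : realType) (X : normedModType R[i])
    (A : operator X) (T : R -> X -> X) : Prop :=
  C0_semigroup T /\
  forall x y : X, (dom A x /\ A x = y) <->
    ((h^-1)%:C *: (T h x - x) @[h --> 0^'+] --> y).

Definition immediately_differentiable (R : realType) (X : normedModType R[i])
    (T : R -> X -> X) : Prop :=
  forall (x : X) (t : R), 0 < t ->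
    cvg ((h^-1)%:C *: (T (t + h) x - T t x) @[h --> 0^']).

Lemma immediately_differentiable_dom (R : realType) (X : normedModType R[i])
    (A : operator X) (T : R -> X -> X) :
  generates A T -> immediately_differentiable T ->
  forall (t : R) (x : X), 0 < t -> dom A (T t x).
Proof.
move=> [sgT genA] dT t x t0.
have /cvg_ex [y /= cy] := dT x t t0.
suff /genA[] : (h^-1)%:C *: (T h (T t x) - T t x) @[h --> 0^'+] --> y by [].
have /cvg_dnbhs_at_right cy' := cy.
apply: cvg_trans cy'; apply: near_eq_cvg.
near=> h.
have h0 : 0 < h by [].
by rewrite [t + h]addrC (sgD sgT _ (ltW h0) (ltW t0)).
Unshelve. all: by end_near.
Qed.

(* By [immediately_differentiable_dom], A T(t) is defined on all of X for
   t > 0. *)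
Definition crandall_pazy (R : realType) (X : normedModType R[i])
    (A : operator X) (T : R -> X -> X) (alpha : R) : Prop :=
  immediately_differentiable T /\
  exists C : R, \forall t \near 0^'+,
    (opnorm (A \o T t) <= (C * t `^ (- alpha^-1))%:E)%E.

Definition subordinate (R : realType) (X : normedModType R[i])
    (theta : R) (A B : operator X) : Prop :=
  dom A `<=` dom B /\
  exists2 c : R, 0 < c & forall x, dom A x ->
    rnorm (B x) <= c * rnorm (A x) `^ theta * rnorm x `^ (1 - theta).

(* A + B on D(A) `&` D(B), which is D(A) when B is subordinate to A
   ([dom_addop]). *)
Section addop.
Context (R : realType) (X : normedModType R[i]) (A B : operator X).

Let D := dom A `&` dom B.

Let D0 : D 0. Proof. by split; exact: dom0. Qed.

Let DP (a : R[i]) (x y : X) : D x -> D y -> D (a *: x + y).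
Proof. by move=> [Ax Bx] [Ay By]; split; exact: domP. Qed.

Let f (x : X) := A x + B x.

Let fP (a : R[i]) (x y : X) : D x -> D y -> f (a *: x + y) = a *: f x + f y.
Proof.
by move=> [Ax Bx] [Ay By]; rewrite /f !appP // scalerDr addrACA.
Qed.

Definition addop : operator X := Operator D0 DP fP.

Lemma dom_addop (theta : R) : subordinate theta A B -> dom addop = dom A.
Proof. by move=> [AB _]; apply/setIidPl. Qed.

End addop.

Definition strongly_stable (R : realType) (X : normedModType R[i])
    (T : R -> X -> X) : Prop :=
  forall x : X, rnorm (T t x) @[t --> +oo] --> (0 : R).

Definition uniformly_exponentially_stable (R : realType)
    (X : normedModType R[i]) (T : R -> X -> X) : Prop :=
  exists M omega : R, [/\ 1 <= M, 0 < omega &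
    forall t, 0 <= t -> (opnorm (T t) <= (M * expR (- (omega * t)))%:E)%E].

(* Main.v *)
Require Import Defs.
From mathcomp Require Import all_boot all_order all_algebra.
From mathcomp Require Import all_classical all_reals all_analysis.
From mathcomp Require Import complex.
From mathcomp Require Import ring lra.
Import Order.TTheory GRing.Theory Num.Theory.
Import numFieldNormedType.Exports.
Local Open Scope classical_set_scope.
Local Open Scope ring_scope.
Local Open Scope complex_scope.

(** For a fixed time t0 and tau = t + t0, the path
      F(s) = S(tau - s) T(s) x,   0 <= s <= t0,
    runs from S(tau) x to S(t) T(t0) x, and since A - (A + B) = - B its
    right derivative at s > 0 is - S(tau - s) B T(s) x.  Hence
      |S(tau) x| <= |S(t) T(t0) x| + int_0^t0 |S(tau - s) B T(s) x| ds,
    and each contribution can be made at most |x| / 4: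

    - Strong stability makes S bounded, by some K ([strongly_stable_bounded], from
      [uniform_boundedness]), and T decays exponentially, so that K |T(t0)| <= 1/4 for a suitable t0.

    - Near s = 0, subordination and the Crandall-Pazy bound give
      |B T(s)| <= G s^(-theta/alpha) ([subordinate_smoothing]), which is
      integrable as theta < alpha; so the part of the integral over (0, delta) is small when delta is, and
      this uniformly in t.

    - For s >= delta one has B T(s) = B T(delta) T(s - delta).  The operator
      B T(delta) is compact, and a bounded family of operators tending to 0
      strongly tends to 0 uniformly on relatively compact sets
      ([compact_uniform_decay]), so
      |S(r) B T(s)| is as small as desired for all r >= t, once t is large.

    Thus |S(tau)| <= 3/4 for some tau > 0, and a bounded semigroup with this
    property decays exponentially ([contraction_uniformly_stable]).

    The integral is never formed.  The increments of F are compared with those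
    of explicit real functions phi (a multiple of s^(1 - theta/alpha) near 0, a
    linear function afterwards) through a mean value inequality that only asks
    for |F(s + h) - F(s)| <= phi(s + h) - phi(s) + o(h) as h -> 0+
    ([norm_growth_le]).  Besides avoiding measurability questions, this works
    for every x at once, since T(s) x lies in the domain of A for s > 0. *)

(** * The norm as a real number *)

Section RealNorm.
Context {R : realType} {X : normedModType R[i]}.
Implicit Types (x y z : X).

Lemma pos_complexP (e : R[i]) : 0 < e -> exists2 d : R, 0 < d & e = d%:C.
Proof.
by case: e => d i; rewrite ltcE /= => /andP[/eqP -> d0]; exists d.
Qed.

Lemma rnormE x : (rnorm x)%:C = `|x|.
Proof. by rewrite /rnorm RRe_real // normr_real. Qed.

Lemma rnorm_ge0 x : 0 <= rnorm x.
Proof. by rewrite -lecR rnormE normr_ge0. Qed.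

Lemma rnorm0 : rnorm (0 : X) = 0.
Proof. by rewrite /rnorm normr0. Qed.

Lemma rnormN x : rnorm (- x) = rnorm x.
Proof. by rewrite /rnorm normrN. Qed.

Lemma rnormD x y : rnorm (x + y) <= rnorm x + rnorm y.
Proof. by rewrite -lecR rmorphD /= !rnormE ler_normD. Qed.

Lemma rnorm_distC x y : rnorm (x - y) = rnorm (y - x).
Proof. by rewrite -rnormN opprB. Qed.

Lemma rnorm_distD y x z : rnorm (x - z) <= rnorm (x - y) + rnorm (y - z).
Proof. by rewrite -[x - z](subrKA y); exact: rnormD. Qed.

Lemma rnormZ (a : R) x : rnorm (a%:C *: x) = `|a| * rnorm x.
Proof.
apply: complexI; rewrite rmorphM /= !rnormE normrZ; congr (_ * _).
by rewrite normc_def /= expr0n addr0 sqrtr_sqr.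
Qed.

Lemma rnorm_eq0 x : rnorm x = 0 -> x = 0.
Proof. by move=> x0; apply/eqP; rewrite -normr_eq0 -rnormE x0. Qed.

Lemma rnorm_cvgP {I : Type} (F : set_system I) {FF : Filter F} (f : I -> X) y :
  f @ F --> y <-> forall e : R, 0 < e -> \forall i \near F, rnorm (f i - y) < e.
Proof.
rewrite cvgrPdist_lt; split=> [fy e e0|fy e].
  have := fy e%:C; rewrite ltcR => /(_ e0).
  by apply: filterS => i; rewrite -rnormE ltcR rnorm_distC.
case/pos_complexP => d d0 ->.
by near do rewrite -rnormE ltcR rnorm_distC; apply: fy.
Unshelve. all: by end_near. Qed.

Lemma rnorm_nbhsP (y : X) (e : R) : 0 < e -> \forall x \near y, rnorm (x - y) < e.
Proof. by move=> e0; have /rnorm_cvgP := @cvg_id _ (nbhs y); exact. Qed.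

End RealNorm.

(** * Uniform boundedness over the complex field *)

Section LinearMap.
Context {R : realType} {X Y : normedModType R[i]} (f : X -> Y).
Context (flin : linear f).

Lemma linear_fun0 : f 0 = 0.
Proof. by have := flin (-1) 0 0; rewrite scaleN1r addr0 oppr0 scaleN1r addNr. Qed.

Lemma linear_funD x y : f (x + y) = f x + f y.
Proof. by have := flin 1 x y; rewrite !scale1r. Qed.

Lemma linear_funZ a x : f (a *: x) = a *: f x.
Proof. by have := flin a x 0; rewrite linear_fun0 !addr0. Qed.

Lemma linear_funB x y : f (x - y) = f x - f y.
Proof. by rewrite linear_funD -scaleN1r linear_funZ scaleN1r. Qed.

End LinearMap.

Section UniformBoundedness.
Context {R : realType} {X : completeNormedModType R[i]}.

(** The centres form a Cauchy sequence, because the [n]-th ball contains all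
    later centres and the radii tend to 0; its limit stays in every ball since
    the balls are closed. *)
Lemma nested_balls_meet (x : nat -> X) (r : nat -> R) :
  (forall n, 0 <= r n) ->
  (forall n, r n.+1 <= n.+1%:R^-1) ->
  (forall n, rnorm (x n.+1 - x n) + r n.+1 <= r n) ->
  exists l, forall n, rnorm (l - x n) <= r n.
Proof.
move=> r0 rS nest.
have nestD n k : rnorm (x (n + k)%N - x n) + r (n + k)%N <= r n.
  elim: k => [|k IH]; first by rewrite addn0 subrr rnorm0 add0r.
  rewrite addnS; have := nest (n + k)%N.
  have := rnorm_distD (x (n + k)%N) (x (n + k).+1) (x n); lra.
have nestW n m : (n <= m)%N -> rnorm (x m - x n) <= r n.
  by move=> /subnKC <-; have := nestD n (m - n)%N; have := r0 (n + (m - n))%N; lra.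
have cx : cvg (x @ \oo).
  apply/cauchy_cvgP/cauchy_exP => e.
  case/pos_complexP => d d0 ->.
  have [N _ /(_ N (leqnn N)) /= rN] := near_infty_natSinv_lt (PosNum d0).
  exists (x N.+1); exists N.+1 => // m /= Nm.
  rewrite -ball_normE /= -rnormE ltcR rnorm_distC.
  by apply: le_lt_trans (nestW _ _ Nm) _; apply: le_lt_trans (rS N) _.
exists (lim (x @ \oo)) => n.
apply/ler_addgt0Pr => e e0.
have /rnorm_cvgP/(_ e e0) [N _ Ne] := cx.
have := Ne (maxn N n) (leq_maxl _ _); rewrite /= rnorm_distC => lt_e.
have := nestW n (maxn N n) (leq_maxr _ _).
have := rnorm_distD (x (maxn N n)) (lim (x @ \oo)) (x n); lra.
Qed.

(** Baire's argument by nested balls.  Either some [n] bounds all the [f i] on a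
    common ball, and linearity turns this into a bound on the whole space; or
    every ball contains a smaller one on which some [f i] exceeds [n], and a
    point common to a sequence of such balls contradicts the pointwise bound. *)
Lemma uniform_boundedness (Y : normedModType R[i]) (I : Type) (D : set I)
    (f : I -> X -> Y) :
  (forall i, D i -> linear (f i)) ->
  (forall i, D i -> continuous (f i)) ->
  (forall x, exists M, forall i, D i -> rnorm (f i x) <= M) ->
  exists2 M, 0 < M & forall i x, D i -> rnorm (f i x) <= M * rnorm x.
Proof.
move=> flin fcont fbnd.
have [[n [x [r [r0 bnd]]]]|unb] := pselect (exists (n : nat) (x : X) (r : R),
    0 < r /\ forall i y, D i -> rnorm (y - x) < r -> rnorm (f i y) <= n%:R).
  exists (4 * n.+1%:R / r); first by rewrite divr_gt0.
  move=> i v Di; have li := flin i Di.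
  have [v0|v0] := eqVneq (rnorm v) 0.
    by rewrite (rnorm_eq0 _ v0) linear_fun0 // !rnorm0 mulr0.
  have {}v0 : 0 < rnorm v by rewrite lt_def v0 rnorm_ge0.
  pose a := r / (2 * rnorm v).
  have a0 : 0 < a by rewrite divr_gt0 ?mulr_gt0.
  have av : a * rnorm v = r / 2 by rewrite /a; field; rewrite gt_eqF.
  have fv : f i (a%:C *: v) = f i (x + a%:C *: v) - f i x.
    by rewrite linear_funD // addrAC subrr add0r.
  have fav : rnorm (f i (a%:C *: v)) = a * rnorm (f i v).
    by rewrite linear_funZ // rnormZ gtr0_norm.
  have b1 : rnorm (f i x) <= n%:R by apply: bnd; rewrite ?subrr ?rnorm0.
  have b2 : rnorm (f i (x + a%:C *: v)) <= n%:R.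
    by apply: bnd; rewrite // addrC addKr rnormZ gtr0_norm // av; lra.
  have : a * rnorm (f i v) <= 2 * n.+1%:R.
    rewrite -fav fv; apply: le_trans (rnormD _ _) _; rewrite rnormN.
    by rewrite -natr1; lra.
  rewrite mulrC -ler_pdivlMr // => /le_trans; apply.
  by rewrite le_eqVlt; apply/orP; left; apply/eqP; rewrite /a; field; rewrite !gt_eqF.
exfalso.
(* The state [p] is a step number, a centre and a radius. *)
have step (p : nat * (X * R)) : exists q : X * R, 0 < p.2.2 ->
    [/\ 0 < q.2, q.2 <= p.1.+1%:R^-1, rnorm (q.1 - p.2.1) + q.2 <= p.2.2 &
      exists2 i, D i & forall z, rnorm (z - q.1) <= q.2 -> p.1%:R < rnorm (f i z)].
  case: p => n [x r] /=.
  have [r0|r0] := ltP 0 r; last by exists (x, r) => ?.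
  have [i [y [Di yx fy]]] : exists i y, [/\ D i, rnorm (y - x) < r & n%:R < rnorm (f i y)].
    apply: contrapT => no; apply: unb; exists n, x, r; split => // i y Di yx.
    by rewrite leNgt; apply/negP => fy; apply: no; exists i, y.
  have e0 : 0 < rnorm (f i y) - n%:R by lra.
  have /rnorm_cvgP/(_ _ e0)/nbhs_ballP[_ /pos_complexP[d d0 ->] near_y] :=
    fcont i Di y.
  pose s := Num.min (n.+1%:R^-1) (Num.min (r - rnorm (y - x)) (d / 2)).
  have s0 : 0 < s by rewrite !lt_min invr_gt0 ltr0n /=; apply/andP; split; lra.
  have s1 : s <= n.+1%:R^-1 by rewrite ge_min lexx.
  have s2 : s <= r - rnorm (y - x) by rewrite !ge_min lexx orbT.
  have s3 : s <= d / 2 by rewrite !ge_min lexx !orbT.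
  exists (y, s) => _; split => //=; first lra.
  exists i => // z zy.
  have : ball y d%:C z.
    by rewrite -ball_normE /= -rnormE rnorm_distC ltcR; lra.
  move=> /near_y /=; have := rnormD (f i y - f i z) (f i z).
  rewrite subrK rnorm_distC; lra.
have [g gP] := choice step.
pose q := fix q n : X * R := if n is n'.+1 then g (n', q n') else (0, 1).
have qr n : 0 < (q n).2 by elim: n => [|n IH] //=; have [] := gP (n, q n) IH.
have [l lP] := @nested_balls_meet (fun n => (q n).1) (fun n => (q n).2)
  (fun n => ltW (qr n)) (fun n => let: And4 _ h _ _ := gP (n, q n) (qr n) in h)
  (fun n => let: And4 _ _ h _ := gP (n, q n) (qr n) in h).
have [M MP] := fbnd l.
pose N := (Num.truncn M).+1.
have [_ _ _ [i Di fi]] := gP (N, q N) (qr N).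
have := lt_le_trans (fi l (lP N.+1)) (MP i Di).
by rewrite /= ltNge ltW // truncnS_gt.
Qed.

End UniformBoundedness.

(** * A mean value inequality for right difference quotients *)

Section RightGrowth.
Context {R : realType}.

Lemma near_at_right0P (P : R -> Prop) :
  (\forall h \near 0^'+, P h) <->
  exists2 d : R, 0 < d & forall h : R, 0 < h -> h < d -> P h.
Proof.
split=> [[d /= d0 dP]|[d d0 dP]]; exists d => //= h.
  by move=> h0 hd; apply: dP => //=; rewrite sub0r normrN gtr0_norm.
by rewrite /= sub0r normrN => /ltr_normlW hd h0; exact: dP.
Qed.

(** For each [eta > 0] the set of points [s] up to which the estimate holds with
    the extra term [eta * (s - a)] contains its supremum, by left continuity of
    [f] and monotonicity of [phi], and cannot stop before [b], by the growth
    condition. *)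
Lemma norm_growth_le {X : normedModType R[i]} (f : R -> X) (phi : R -> R) (a b : R) :
  a <= b ->
  (forall s s', a <= s -> s <= s' -> s' <= b -> phi s <= phi s') ->
  (forall s, a < s -> s <= b -> f (s - h) @[h --> 0^'+] --> f s) ->
  (forall s eta, a <= s -> s < b -> 0 < eta -> \forall h \near 0^'+,
     rnorm (f (s + h) - f s) <= phi (s + h) - phi s + eta * h) ->
  rnorm (f b - f a) <= phi b - phi a.
Proof.
move=> ab phi_mono lcont growth; apply/ler_addgt0Pr => e e0.
pose eta := e / (b - a + 1).
have eta0 : 0 < eta by rewrite divr_gt0 //; lra.
pose E := [set s | [/\ a <= s, s <= b &
  rnorm (f s - f a) <= phi s - phi a + eta * (s - a)]].
have Ea : E a by split; rewrite // !subrr rnorm0 mulr0 addr0.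
have supE : has_sup E by split; [exists a | exists b => s []].
have am : a <= sup E by exact: sup_upper_bound.
have mb : sup E <= b by apply: ge_sup; [exists a | move=> s []].
have Em : E (sup E).
  have [->|m_neq_a] := eqVneq (sup E) a; first exact: Ea.
  have {m_neq_a} am' : a < sup E by rewrite lt_def m_neq_a am.
  split => //; apply/ler_addgt0Pr => e' e'0.
  have /rnorm_cvgP/(_ e' e'0)/near_at_right0P[d d0 near_m] := lcont _ am' mb.
  have [s Es sm] := sup_adherent d0 supE.
  have := sup_upper_bound supE Es; rewrite le_eqVlt => /predU1P[<-|sm'].
    by case: Es => _ _; lra.
  case: Es => as_ sb Es.
  have := near_m (sup E - s); rewrite subKr => /(_ ltac:(lra) ltac:(lra)) fsm.
  have := rnorm_distD (f s) (f (sup E)) (f a); rewrite rnorm_distC in fsm.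
  have := phi_mono _ _ as_ (ltW sm') mb.
  have : eta * (s - a) <= eta * (sup E - a) by rewrite ler_pM2l //; lra.
  lra.
have [mltb|] := ltP (sup E) b; last first.
  move=> bm; have m_eq_b : sup E = b by apply/eqP; rewrite eq_le mb.
  case: Em => _ _; rewrite m_eq_b => /le_trans; apply.
  rewrite lerD2l /eta mulrAC ler_pdivrMr ?ler_pM2l; lra.
have /near_at_right0P[d d0 dP] := growth _ _ am mltb eta0.
pose h := Num.min (d / 2) (b - sup E).
have h0 : 0 < h by rewrite lt_min; apply/andP; split; lra.
have hd : h <= d / 2 by rewrite ge_min lexx.
have hb : h <= b - sup E by rewrite ge_min lexx orbT.
have Emh : E (sup E + h).
  split; [lra|lra|].
  have := dP h h0 ltac:(lra); case: Em => _ _.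
  have := rnorm_distD (f (sup E)) (f (sup E + h)) (f a).
  lra.
by have := sup_upper_bound supE Emh; lra.
Qed.

(** The derivative of a power, in the form of the growth condition of
    [norm_growth_le]. *)
Lemma powR_growth (g s eta : R) : 0 < s -> 0 < eta ->
  \forall h \near 0^'+, g * s `^ (g - 1) * h <= (s + h) `^ g - s `^ g + eta * h.
Proof.
move=> s0 eta0.
have [dd dv] := is_derive1_powR g s0.
have : (fun h : R => h^-1 *: ((h *: (1 : R) + s) `^ g - s `^ g)) @ 0^'+ --> g * s `^ (g - 1).
  by apply: cvg_dnbhs_at_right; rewrite -dv; exact: dd.
move=> /cvgrPdist_lt/(_ _ eta0)/near_at_right0P[d d0 dP].
apply/near_at_right0P; exists d => // h h0 hd.
have := dP h h0 hd => /ltr_normlW.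
rewrite /GRing.scale /= mulr1 [h + s]addrC ltrBlDr => /ltW.
by rewrite -(ler_pM2r h0) mulrDl [h^-1 * _]mulrC mulfVK ?gt_eqF // [leRHS]addrC.
Qed.

End RightGrowth.

(** * Bounded operators and uniform decay on compact sets *)

Section OperatorBounds.
Context {R : realType} {X : normedModType R[i]}.
Implicit Types f : X -> X.

Lemma opnorm_leP f (m : R) :
  (opnorm f <= m%:E)%E <-> forall x, rnorm x <= 1 -> rnorm (f x) <= m.
Proof.
split=> [fm x x1|fm].
  rewrite -lee_fin; apply: le_trans fm; apply: ereal_sup_ubound.
  by exists x.
by apply: ge_ereal_sup => _ [x x1 <-]; rewrite lee_fin; exact: fm.
Qed.

Lemma linear_bound_unit_ball {Y : normedModType R[i]} (f : X -> Y) (m : R) : linear f ->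
  (forall x, rnorm x <= 1 -> rnorm (f x) <= m) ->
  forall x, rnorm (f x) <= m * rnorm x.
Proof.
move=> flin fm x; have [x0|x0] := eqVneq (rnorm x) 0.
  by rewrite (rnorm_eq0 _ x0) linear_fun0 // !rnorm0 mulr0.
have {}x0 : 0 < rnorm x by rewrite lt_def x0 rnorm_ge0.
have := fm ((rnorm x)^-1%:C *: x).
rewrite linear_funZ // !rnormZ gtr0_norm ?invr_gt0 // mulVf ?gt_eqF // lexx.
by move=> /(_ isT); rewrite mulrC ler_pdivrMr.
Qed.

(** Equicontinuity propagates the decay at a point [y] to a neighbourhood of
    [y], and compactness reduces to finitely many of these neighbourhoods. *)
Lemma compact_uniform_decay (T : R -> X -> X) (C : set X) (K : R) :
  0 < K ->
  (forall t, 0 <= t -> linear (T t)) ->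
  (forall t x, 0 <= t -> rnorm (T t x) <= K * rnorm x) ->
  strongly_stable T -> precompact C ->
  forall e : R, 0 < e -> \forall t \near +oo, forall y, C y -> rnorm (T t y) <= e.
Proof.
move=> K0 Tlin TK stab; rewrite precompactE => /compact_near_coveringP cov e e0.
have e2 : 0 < e / 2 by lra.
have eK : 0 < e / (2 * K) by rewrite divr_gt0 // mulr_gt0.
have : \forall t \near +oo, closure C `<=` (fun y => rnorm (T t y) <= e).
  apply: cov => y _.
  near=> z t.
  have t0 : 0 <= t by near: t; exact: nbhs_pinfty_ge.
  have zy : rnorm (z - y) < e / (2 * K) by near: z; exact: rnorm_nbhsP.
  have ty : rnorm (T t y) < e / 2.
    near: t; have /cvgrPdist_lt/(_ _ e2) := stab y; apply: filterS => t.
    by rewrite sub0r normrN ger0_norm ?rnorm_ge0.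
  have -> : z = (z - y) + y by rewrite subrK.
  rewrite linear_funD; last exact: Tlin.
  have := rnormD (T t (z - y)) (T t y); have := TK t (z - y) t0.
  have : K * rnorm (z - y) < e / 2.
    have -> : e / 2 = K * (e / (2 * K)) by field; rewrite gt_eqF.
    by rewrite ltr_pM2l.
  lra.
by apply: filterS => t Ct y Cy; apply: Ct; exact: subset_closure.
Unshelve. all: by end_near. Qed.

End OperatorBounds.

(** * Bounded and stable semigroups *)

Section Semigroups.
Context {R : realType} {X : completeNormedModType R[i]}.
Implicit Types (T S : R -> X -> X).

(** Uniform boundedness for a family with one member. *)
Lemma continuous_linear_bound (f : X -> X) : linear f -> continuous f ->
  exists2 M, 0 < M & forall x, rnorm (f x) <= M * rnorm x.
Proof.
move=> flin fcont.
have [_ _|_ _|x|M M0 MP] := @uniform_boundedness R X X unit setT (fun=> f).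
- exact: flin.
- exact: fcont.
- by exists (rnorm (f x)).
- by exists M => // x; exact: (MP tt).
Qed.

Lemma orbit_near0_bound T x : C0_semigroup T ->
  exists2 d, 0 < d & exists M, forall t, 0 <= t -> t <= d -> rnorm (T t x) <= M.
Proof.
move=> sgT; have /rnorm_cvgP/(_ _ ltr01)/near_at_right0P[d d0 dP] := @sg_cvg _ _ _ sgT x.
exists (d / 2); first lra.
exists (1 + rnorm x) => t; rewrite le_eqVlt => /predU1P[<- _|t0 td].
  by rewrite (sg0 sgT); lra.
have := dP t t0 ltac:(lra); have := rnormD (T t x - x) x; rewrite subrK; lra.
Qed.

(** The orbit is bounded on a small interval [0, d], hence by the semigroup law
    on every [0, n d], and it is at most 1 in norm from some time on. *)
Lemma strongly_stable_orbit_bound T x : C0_semigroup T -> strongly_stable T ->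
  exists M, forall t, 0 <= t -> rnorm (T t x) <= M.
Proof.
move=> sgT stab; have [d d0 [M0 M0P]] := orbit_near0_bound T x sgT.
have bnd (n : nat) : exists M, forall t, 0 <= t -> t <= n%:R * d -> rnorm (T t x) <= M.
  elim: n => [|n [M IH]].
    by exists M0 => t t0; rewrite mul0r => td; apply: M0P => //; lra.
  have nd : 0 <= n%:R * d by rewrite mulr_ge0 // ltW.
  have [K K0 KP] := continuous_linear_bound _ (sg_linear sgT nd) (sg_continuous sgT nd).
  exists (Num.max M (K * M0)) => t t0; rewrite -natr1 mulrDl mul1r => td.
  rewrite le_max; have [tn|nt] := leP t (n%:R * d); first by rewrite IH.
  apply/orP; right.
  have -> : t = n%:R * d + (t - n%:R * d) by ring.
  rewrite (sgD sgT) //; last lra.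
  by apply: le_trans (KP _) _; rewrite ler_pM2l //; apply: M0P; lra.
have /cvgrPdist_lt/(_ _ ltr01)[N [_ NP]] := stab x.
have [M MP] := bnd (Num.truncn (N / d)).+1.
exists (Num.max M 1) => t t0; rewrite le_max.
have [tN|Nt] := leP t N.
  rewrite MP // (le_trans tN) // -ler_pdivrMr // ltW // truncnS_gt //.
by have := NP t Nt; rewrite sub0r normrN ger0_norm ?rnorm_ge0 // => /ltW ->; rewrite orbT.
Qed.

Lemma strongly_stable_bounded T : C0_semigroup T -> strongly_stable T ->
  exists2 K, 1 <= K & forall t x, 0 <= t -> rnorm (T t x) <= K * rnorm x.
Proof.
move=> sgT stab.
have [t t0|t t0|x|K K0 KP] := @uniform_boundedness R X X R [set t | 0 <= t] T.
- exact: sg_linear.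
- exact: sg_continuous.
- by have [M MP] := strongly_stable_orbit_bound T x sgT stab; exists M.
exists (K + 1) => [|t x t0]; first lra.
by apply: le_trans (KP t x t0) _; rewrite ler_wpM2r ?rnorm_ge0 //; lra.
Qed.

(** Write [t = n t1 + r] with [0 <= r < t1]; then [|T t| <= K q^n], and
    [q^n <= q^(t / t1) / q] because [n > t / t1 - 1]. *)
Lemma contraction_uniformly_stable T (K q t1 : R) : C0_semigroup T ->
  1 <= K -> (forall t x, 0 <= t -> rnorm (T t x) <= K * rnorm x) ->
  0 < t1 -> 0 < q -> q < 1 -> (forall x, rnorm (T t1 x) <= q * rnorm x) ->
  uniformly_exponentially_stable T.
Proof.
move=> sgT K1 TK t10 q0 q1 Tq.
have lnq : ln q < 0 by rewrite -ln1 ltr_ln // posrE.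
exists (K / q), (- ln q / t1); split.
- rewrite ler_pdivlMr //; lra.
- by rewrite divr_gt0 // oppr_gt0.
move=> t t0; apply/opnorm_leP => x x1.
pose n := Num.truncn (t / t1).
have /andP[nt tn] : n%:R <= t / t1 < n.+1%:R.
  by rewrite truncn_itv // divr_ge0 // ltW.
have n0 : 0 <= n%:R * t1 by rewrite mulr_ge0 // ltW.
have Tn m y : rnorm (T (m%:R * t1) y) <= q ^+ m * rnorm y.
  elim: m y => [|m IH] y; first by rewrite mul0r (sg0 sgT) expr0 mul1r.
  have m0 : 0 <= m%:R * t1 by rewrite mulr_ge0 // ltW.
  rewrite -natr1 mulrDl mul1r (sgD sgT) // ?(ltW t10) //.
  apply: le_trans (IH _) _; rewrite exprSr -mulrA ler_pM2l ?exprn_gt0 //; exact: Tq.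
have r0 : 0 <= t - n%:R * t1 by rewrite subr_ge0 -ler_pdivlMr.
have -> : t = (t - n%:R * t1) + n%:R * t1 by ring.
rewrite (sgD sgT) // subrK; apply: le_trans (TK _ _ r0) _.
rewrite -mulrA ler_wpM2l //; first lra.
apply: le_trans (Tn n x) _; apply: (@le_trans _ _ (q ^+ n)).
  by rewrite -[leRHS]mulr1 ler_pM2l ?exprn_gt0.
have qE : q = expR (ln q) by rewrite lnK // posrE.
rewrite [leLHS](_ : _ = expR (n%:R * ln q)); last by rewrite expRM_natl -qE.
rewrite [q^-1](_ : _ = expR (- ln q)); last by rewrite expRN -qE.
rewrite -expRD ler_expR.
have -> : - (- ln q / t1 * t) = ln q * (t / t1) by field; rewrite gt_eqF.
have : (n%:R + 1 - t / t1) * ln q <= 0 by rewrite pmulr_rle0 ?ltW // subr_gt0 natr1.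
lra.
Qed.

End Semigroups.

(** * Comparing the perturbed and the unperturbed semigroup *)

Section Perturbation.
Context {R : realType} {X : completeNormedModType R[i]}.
Context (A B : operator X) (T S : R -> X -> X) (M K : R).
Context (genA : generates A T) (genAB : generates (addop A B) S).
Context (M_ge1 : 1 <= M) (K_ge1 : 1 <= K).
Context (T_bound : forall (t : R) x, 0 <= t -> rnorm (T t x) <= M * rnorm x).
Context (S_bound : forall (t : R) x, 0 <= t -> rnorm (S t x) <= K * rnorm x).
Context (T_dom : forall (t : R) x, 0 < t -> dom A (T t x)).
Context (domAB : dom A `<=` dom B).

Let sgT := genA.1.
Let sgS := genAB.1.
Let K_gt0 : 0 < K. Proof. exact: lt_le_trans ltr01 K_ge1. Qed.
Let M_gt0 : 0 < M. Proof. exact: lt_le_trans ltr01 M_ge1. Qed.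

(** The generators of [T] and [S] differ by [- B] at [y]. *)
Lemma generator_difference y (eta : R) : dom A y -> 0 < eta ->
  \forall h \near 0^'+, rnorm (T h y - S h y + h%:C *: B y) <= eta * h.
Proof.
move=> Ay eta0; have By := domAB _ Ay.
have cT := (genA.2 y (A y)).1 (conj Ay erefl).
have cS := (genAB.2 y (A y + B y)).1 (conj (conj Ay By) erefl).
have cTS : (h^-1)%:C *: (T h y - y) - (h^-1)%:C *: (S h y - y) @[h --> 0^'+] -->
    A y - (A y + B y) by exact: cvgB.
move/rnorm_cvgP : cTS => /(_ _ eta0)/near_at_right0P[d d0 dP].
apply/near_at_right0P; exists d => // h h0 hd.
have -> : T h y - S h y + h%:C *: B y = h%:C *:
    ((h^-1)%:C *: (T h y - y) - (h^-1)%:C *: (S h y - y) - (A y - (A y + B y))).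
  rewrite [- (A y + B y)]opprD [A y + _]addrA subrr sub0r opprK.
  rewrite scalerDr scalerBr !scalerA -!rmorphM /=.
  by rewrite divff ?gt_eqF // !scale1r opprB addrA subrK.
rewrite rnormZ gtr0_norm // mulrC ler_pM2r // ltW //; exact: (dP h h0 hd).
Qed.

(** Writing [S r y = S (r - h) (S h y)] gives
    S(r - h) T(h) y - S(r) y = S(r - h) (T(h) y - S(h) y), where the vector in
    parentheses is - h B y up to o(h).  The bound [g] is required at all times
    from [r - d] on, so that [S (r - h)] need not be compared with [S r]. *)
Lemma product_right_growth y (r g d eta : R) : dom A y -> 0 < d -> d <= r ->
  (forall r', r - d <= r' -> rnorm (S r' (B y)) <= g) -> 0 < eta ->
  \forall h \near 0^'+, rnorm (S (r - h) (T h y) - S r y) <= g * h + eta * h.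
Proof.
move=> Ay d0 dr SBg eta0.
have e0 : 0 < eta / K by rewrite divr_gt0.
have /near_at_right0P[d1 d10 d1P] := generator_difference y _ Ay e0.
apply/near_at_right0P; exists (Num.min d1 d); first by rewrite lt_min d10.
move=> h h0; rewrite lt_min => /andP[hd1 hd].
have rh : 0 <= r - h by lra.
have lin := sg_linear sgS rh.
have -> : S r y = S (r - h) (S h y) by rewrite -(sgD sgS) ?subrK // ltW.
have -> : S (r - h) (T h y) - S (r - h) (S h y) =
    S (r - h) (T h y - S h y + h%:C *: B y) - h%:C *: S (r - h) (B y).
  by rewrite linear_funD // linear_funZ // linear_funB // addrK.
apply: le_trans (rnormD _ _) _; rewrite rnormN rnormZ gtr0_norm // addrC.
apply: lerD; first by rewrite mulrC ler_pM2r //; apply: SBg; lra.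
apply: le_trans (S_bound _ _ rh) _.
have -> : eta * h = K * (eta / K * h) by field; rewrite gt_eqF.
by rewrite ler_pM2l //; exact: d1P.
Qed.

(** With v = S(tau - s), the difference of the two products is
    v (S(h) T(s - h) x - T(s - h) T(h) x); insert S(h) T(s - h) T(h) x, and use
    right continuity at 0 of the orbits of [x] under [T] and of [T s x] under
    [S]. *)
Lemma product_left_cvg (tau : R) x (s : R) : 0 < s -> s <= tau ->
  S (tau - (s - h)) (T (s - h) x) @[h --> 0^'+] --> S (tau - s) (T s x).
Proof.
move=> s0 st; apply/rnorm_cvgP => e e0.
have e1 : 0 < e / (2 * K * K * M) by rewrite divr_gt0 // !mulr_gt0.
have e2 : 0 < e / (2 * K) by rewrite divr_gt0 // mulr_gt0.
have /rnorm_cvgP/(_ _ e1)/near_at_right0P[d1 d10 d1P] := @sg_cvg _ _ _ sgT x.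
have /rnorm_cvgP/(_ _ e2)/near_at_right0P[d2 d20 d2P] := @sg_cvg _ _ _ sgS (T s x).
apply/near_at_right0P; exists (Num.min s (Num.min d1 d2)).
  by rewrite !lt_min s0 d10.
move=> h h0; rewrite !lt_min => /and3P[hs hd1 hd2].
have sh : 0 <= s - h by lra.
have ts : 0 <= tau - s by lra.
have h0' := ltW h0.
have -> : tau - (s - h) = (tau - s) + h by ring.
rewrite (sgD sgS) // -linear_funB; last exact: sg_linear.
apply: le_lt_trans (S_bound _ _ ts) _.
have := rnorm_distD (S h (T s x)) (S h (T (s - h) x)) (T s x).
rewrite -linear_funB; last exact: sg_linear.
have -> : T s x = T (s - h) (T h x) by rewrite -(sgD sgT) // subrK.
rewrite -linear_funB; last exact: sg_linear.
rewrite -[T (s - h) (T h x)](sgD sgT) // subrK.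
have := S_bound h (T (s - h) (x - T h x)) h0'.
have : K * rnorm (T (s - h) (x - T h x)) <= K * (M * rnorm (x - T h x)).
  by rewrite ler_pM2l //; exact: T_bound.
have : K * (M * rnorm (x - T h x)) < e / (2 * K).
  have -> : e / (2 * K) = K * (M * (e / (2 * K * K * M))).
    by field; rewrite !gt_eqF.
  by rewrite !ltr_pM2l // rnorm_distC; exact: d1P.
have := d2P h h0 hd2.
move=> *.
have -> : e = K * (e / (2 * K) + e / (2 * K)) by field; rewrite gt_eqF.
rewrite ltr_pM2l //; lra.
Qed.

(** The inequality of Duhamel's formula between two positive times, with [phi]
    in the role of a primitive of the bound [g]. *)
Lemma product_increment (tau : R) x (a b : R) (g phi : R -> R) :
  0 < a -> a <= b -> b <= tau ->
  (forall s s', a <= s -> s <= s' -> s' <= b -> phi s <= phi s') ->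
  (forall s eta, a <= s -> s < b -> 0 < eta ->
     \forall h \near 0^'+, g s * h <= phi (s + h) - phi s + eta * h) ->
  (forall s r, a <= s -> s < b -> tau - b <= r -> rnorm (S r (B (T s x))) <= g s) ->
  rnorm (S (tau - b) (T b x) - S (tau - a) (T a x)) <= phi b - phi a.
Proof.
move=> a0 ab bt phi_mono phi_growth SBT.
apply: (@norm_growth_le R X (fun s => S (tau - s) (T s x))) => //.
  by move=> s as_ sb; apply: product_left_cvg; lra.
move=> s eta as_ sb eta0.
have s0 : 0 < s by lra.
have eta2 : 0 < eta / 2 by lra.
have := @product_right_growth (T s x) (tau - s) (g s) (b - s) (eta / 2) (T_dom _ _ s0).
move=> /(_ ltac:(lra) ltac:(lra) _ eta2).
case/(_ _)/near_at_right0P => [r' r'P|d1 d10 d1P]; first by apply: SBT => //; lra.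
have /near_at_right0P[d2 d20 d2P] := phi_growth s _ as_ sb eta2.
apply/near_at_right0P; exists (Num.min d1 d2); first by rewrite lt_min d10.
move=> h h0; rewrite lt_min => /andP[hd1 hd2].
have := d1P h h0 hd1; have := d2P h h0 hd2.
rewrite -(sgD sgT) ?(ltW h0) ?(ltW s0) //.
have -> : tau - (s + h) = tau - s - h by ring.
rewrite [h + s]addrC; lra.
Qed.

(** The path is continuous at 0, where differentiability may fail. *)
Lemma product_increment0 (tau : R) x (b m : R) : 0 < b -> b <= tau ->
  (forall a, 0 < a -> a <= b ->
    rnorm (S (tau - b) (T b x) - S (tau - a) (T a x)) <= m) ->
  rnorm (S (tau - b) (T b x) - S tau x) <= m.
Proof.
move=> b0 bt incr; apply/ler_addgt0Pr => e e0.
have eK : 0 < e / (2 * K) by rewrite divr_gt0 // mulr_gt0.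
have /rnorm_cvgP/(_ _ eK)/near_at_right0P[d1 d10 d1P] := @sg_cvg _ _ _ sgT x.
have /rnorm_cvgP/(_ _ eK)/near_at_right0P[d2 d20 d2P] := @sg_cvg _ _ _ sgS x.
pose a := Num.min (b / 2) (Num.min (d1 / 2) (d2 / 2)).
have a0 : 0 < a by rewrite !lt_min; apply/and3P; split; lra.
have ab : a <= b / 2 by rewrite ge_min lexx.
have ad1 : a <= d1 / 2 by rewrite !ge_min lexx orbT.
have ad2 : a <= d2 / 2 by rewrite !ge_min lexx !orbT.
have ta : 0 <= tau - a by lra.
have := incr a a0 ltac:(lra).
have := rnorm_distD (S (tau - a) (T a x)) (S (tau - b) (T b x)) (S tau x).
have -> : S tau x = S (tau - a) (S a x) by rewrite -(sgD sgS) ?subrK // ltW.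
rewrite -linear_funB; last exact: sg_linear.
have := S_bound _ (T a x - S a x) ta.
have : K * rnorm (T a x - S a x) <= e.
  have -> : e = K * (e / (2 * K) + e / (2 * K)) by field; rewrite gt_eqF.
  rewrite ler_pM2l //; have := rnorm_distD x (T a x) (S a x).
  have := d1P a a0 ltac:(lra); have := d2P a a0 ltac:(lra).
  by rewrite [rnorm (S a x - x)]rnorm_distC; lra.
lra.
Qed.

(** The right-hand side is K G times the integral of s^(- beta) over
    (0, b). *)
Lemma singular_increment (tau : R) x (b G beta : R) :
  0 <= G -> 0 < beta -> beta < 1 -> 0 < b -> b <= tau ->
  (forall s, 0 < s -> s < b -> rnorm (B (T s x)) <= G * s `^ (- beta)) ->
  rnorm (S (tau - b) (T b x) - S tau x) <= K * G / (1 - beta) * b `^ (1 - beta).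
Proof.
move=> G0 beta0 beta1 b0 bt BT.
have c0 : 0 < 1 - beta by lra.
set D := K * G / (1 - beta).
have D0 : 0 <= D by apply: divr_ge0 (ltW c0); exact: mulr_ge0 (ltW K_gt0) G0.
apply: product_increment0 => // a a0 ab.
apply: (@le_trans _ _ (D * b `^ (1 - beta) - D * a `^ (1 - beta))); last first.
  by rewrite gerBl mulr_ge0 ?powR_ge0.
apply: (@product_increment tau x a b (fun s => K * (G * s `^ (- beta)))
  (fun s => D * s `^ (1 - beta))) => //.
- move=> s s' as_ ss' s'b; rewrite ler_wpM2l //.
  by apply: ge0_ler_powR => //; rewrite ?nnegrE; lra.
- move=> s eta as_ sb eta0.
  have eD : 0 < eta / (D + 1) by rewrite divr_gt0 //; lra.
  have s0 : 0 < s by lra.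
  have /near_at_right0P[d d0 dP] := powR_growth (1 - beta) s _ s0 eD.
  apply/near_at_right0P; exists d => // h h0 hd.
  have := ler_wpM2l D0 (dP h h0 hd).
  have -> : 1 - beta - 1 = - beta by ring.
  have -> : D * ((1 - beta) * s `^ (- beta) * h) = K * (G * s `^ (- beta)) * h.
    by rewrite /D; field; rewrite gt_eqF.
  have : D * (eta / (D + 1) * h) <= eta * h.
    rewrite mulrA ler_pM2r // mulrCA -[leRHS]mulr1 ler_pM2l //.
    rewrite ler_pdivrMr; lra.
  lra.
- move=> s r as_ sb rt.
  apply: le_trans (S_bound _ _ _) _; first lra.
  by rewrite ler_pM2l //; apply: BT; lra.
Qed.

Lemma regular_increment (tau : R) x (a b e : R) : 0 < a -> a <= b -> b <= tau ->
  (forall s r, a <= s -> s < b -> tau - b <= r -> rnorm (S r (B (T s x))) <= e) ->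
  0 <= e ->
  rnorm (S (tau - b) (T b x) - S (tau - a) (T a x)) <= e * (b - a).
Proof.
move=> a0 ab bt SBT e0; rewrite mulrBr.
apply: (@product_increment tau x a b (fun=> e) (fun s => e * s)) => //.
  by move=> s s' _ ss' _; rewrite ler_wpM2l.
move=> s eta _ _ eta0; apply/near_at_right0P; exists 1 => // h h0 _.
have : 0 < eta * h by rewrite mulr_gt0.
lra.
Qed.

End Perturbation.

(** * Smoothing by the unperturbed semigroup and the stability theorem *)

(** Interpolate between |A T(s)| = O(s^(- 1 / alpha)), with weight [theta], and
    the boundedness of [T], with weight [1 - theta]. *)
Lemma subordinate_smoothing {R : realType} {X : normedModType R[i]}
    (A B : operator X) (T : R -> X -> X) (alpha theta M : R) :
  0 < alpha -> 0 < theta -> theta <= 1 -> 0 <= M ->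
  (forall t x, 0 < t -> dom A (T t x)) ->
  (forall t x, 0 <= t -> rnorm (T t x) <= M * rnorm x) ->
  crandall_pazy A T alpha -> subordinate theta A B ->
  exists2 G, 0 <= G & exists2 d, 0 < d & forall s x, 0 < s -> s < d ->
    rnorm x <= 1 -> rnorm (B (T s x)) <= G * s `^ (- (theta / alpha)).
Proof.
move=> alpha0 theta0 theta1 M0 T_dom T_bound [_ [C AT]] [_ [c c0 AB]].
have /near_at_right0P[d d0 dP] := AT.
exists (c * `|C| `^ theta * M `^ (1 - theta)).
  by rewrite !mulr_ge0 ?powR_ge0 // ltW.
exists d => // s x s0 sd x1.
have Ms : rnorm (T s x) <= M.
  apply: le_trans (T_bound _ _ (ltW s0)) _.
  by rewrite -[leRHS]mulr1 ler_wpM2l.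
have As : rnorm (A (T s x)) <= `|C| * s `^ (- alpha^-1).
  have /opnorm_leP/(_ x x1) := dP s s0 sd; move/le_trans; apply.
  by rewrite ler_wpM2r ?powR_ge0 // ler_norm.
apply: le_trans (AB _ (T_dom _ _ s0)) _.
have -> : - (theta / alpha) = - alpha^-1 * theta by rewrite mulNr mulrC.
rewrite powRrM [leRHS]mulrAC -[_ * _ * (s `^ _ `^ _)]mulrA -powRM ?powR_ge0 //.
apply: ler_pM; rewrite ?mulr_ge0 ?powR_ge0 ?(ltW c0) //.
  rewrite ler_pM2l //; apply: ge0_ler_powR => //;
    rewrite ?nnegrE ?mulr_ge0 ?rnorm_ge0 ?powR_ge0 //.
  exact: ltW.
by apply: ge0_ler_powR; rewrite ?nnegrE ?rnorm_ge0 //; lra.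
Qed.

Theorem corollary3 (R : realType) (X : completeNormedModType R[i])
    (A B : operator X) (T S : R -> X -> X) (alpha theta : R)
    (alpha_gt0 : 0 < alpha) (alpha_le1 : alpha <= 1)
    (genA : generates A T)
    (stableT : uniformly_exponentially_stable T)
    (cpT : crandall_pazy A T alpha)
    (theta_gt0 : 0 < theta) (theta_lt : theta < alpha)
    (subB : subordinate theta A B)
    (compactBT : forall t : R, 0 < t -> compact_operator (B \o T t))
    (genAB : generates (addop A B) S) :
  strongly_stable S -> uniformly_exponentially_stable S.
Proof.
move=> stabS; have [sgT sgS] := (genA.1, genAB.1).
have [K K1 SK] := strongly_stable_bounded S sgS stabS.
have K0 : 0 < K by lra.
have [M [omega [M1 omega0 Texp]]] := stableT.
have M0 : 0 < M by lra.
have TE (t : R) x : 0 <= t -> rnorm (T t x) <= M * expR (- (omega * t)) * rnorm x.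
  move=> t0; apply: linear_bound_unit_ball; first exact: sg_linear.
  exact/opnorm_leP/Texp.
have TM (t : R) x : 0 <= t -> rnorm (T t x) <= M * rnorm x.
  move=> t0; apply: le_trans (TE t x t0) _; rewrite ler_wpM2r ?rnorm_ge0 //.
  by rewrite -[leRHS]mulr1 ler_pM2l // expR_le1 oppr_le0 mulr_ge0 // ltW.
have T_dom (t : R) x : 0 < t -> dom A (T t x).
  exact: (immediately_differentiable_dom genA cpT.1).
have domAB := subB.1.
set beta := theta / alpha.
have beta0 : 0 < beta by rewrite divr_gt0.
have beta1 : beta < 1 by rewrite ltr_pdivrMr // mul1r.
have [G G0 [d d0 BT]] := subordinate_smoothing A B T alpha theta M alpha_gt0
  theta_gt0 ltac:(lra) (ltW M0) T_dom TM cpT subB.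
have [t0 t00 Tt0] : exists2 t0, 0 < t0 &
    forall x, rnorm x <= 1 -> K * rnorm (T t0 x) <= 1 / 4.
  (* exp (omega t0) >= 1 + omega t0 >= 4 K M for t0 = 4 K M / omega. *)
  have t00 : 0 < 4 * K * M / omega by rewrite divr_gt0 // !mulr_gt0.
  exists (4 * K * M / omega) => // x x1; set t0 := _ / omega in t00 *.
  have e4 : 4 * K * M * expR (- (omega * t0)) <= 1.
    rewrite expRN ler_pdivrMr ?expR_gt0 // mul1r.
    apply: le_trans (expR_ge1Dx _).
    by rewrite /t0 [omega * _]mulrC divfK ?gt_eqF //; lra.
  have ME : rnorm (T t0 x) <= M * expR (- (omega * t0)).
    apply: le_trans (TE _ _ (ltW t00)) _.
    by rewrite -[leRHS]mulr1 ler_wpM2l // mulr_ge0 ?expR_ge0 // ltW.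
  have : K * rnorm (T t0 x) <= K * (M * expR (- (omega * t0))) by rewrite ler_pM2l.
  lra.
set D := K * G / (1 - beta).
have D0 : 0 <= D by apply: divr_ge0; [exact: mulr_ge0 (ltW K0) G0|lra].
have e1 : 0 < 1 / (4 * (D + 1)) by rewrite divr_gt0 // mulr_gt0 //; lra.
have beta1' : 0 < 1 - beta by lra.
have /cvgrPdist_lt/(_ _ e1)/near_at_right0P[d1 d10 d1P] := powR_cvg0 beta1'.
pose delta := Num.min (d / 2) (Num.min (d1 / 2) t0).
have delta0 : 0 < delta by rewrite !lt_min; apply/and3P; split; lra.
have delta_d : delta <= d / 2 by rewrite ge_min lexx.
have delta_d1 : delta <= d1 / 2 by rewrite !ge_min lexx orbT.
have delta_t0 : delta <= t0 by rewrite !ge_min lexx !orbT.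
have Ddelta : D * delta `^ (1 - beta) <= 1 / 4.
  have := d1P delta delta0 ltac:(lra).
  rewrite sub0r normrN ger0_norm ?powR_ge0 // => /ltW h.
  apply: le_trans (ler_wpM2l D0 h) _.
  by rewrite mulrA mulr1 ler_pdivrMr ?mulr_gt0 //; lra.
have e2 : 0 < 1 / (4 * t0 * M) by rewrite divr_gt0 // !mulr_gt0.
have [N [_ NP]] := compact_uniform_decay S _ K K0 (@sg_linear _ _ _ sgS) SK stabS
  (compactBT delta delta0) _ e2.
pose t := Num.max (N + 1) 1.
have t_gt0 : 0 < t by rewrite lt_max ltr01 orbT.
have tN : N + 1 <= t by rewrite le_max lexx.
pose tau := t + t0.
(* B T(s) = B T(delta) T(s - delta) carries the unit ball into M times a
   relatively compact set on which S is uniformly small. *)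
have lateSBT s r x : rnorm x <= 1 -> delta <= s -> t <= r ->
    rnorm (S r (B (T s x))) <= 1 / (4 * t0).
  move=> x1 ds tr.
  have lin : linear (fun y => S r (B (T delta y))).
    move=> a y z; rewrite (sg_linear sgT) ?(ltW delta0) //.
    rewrite Defs.appP ?(sg_linear sgS) //; first lra.
      by apply: domAB; exact: T_dom.
    by apply: domAB; exact: T_dom.
  have sd : 0 <= s - delta by lra.
  have -> : T s x = T delta (T (s - delta) x).
    by rewrite -(sgD sgT) ?(ltW delta0) // addrC subrK.
  apply: le_trans (linear_bound_unit_ball _ (1 / (4 * t0 * M)) lin _ _) _.
    by move=> y y1; apply: NP; [lra|exists y].
  have -> : 1 / (4 * t0) = 1 / (4 * t0 * M) * M by field; rewrite !gt_eqF.
  rewrite ler_pM2l //; apply: le_trans (TM _ _ sd) _.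
  by rewrite -[leRHS]mulr1 ler_pM2l.
apply: (contraction_uniformly_stable S K (3 / 4) tau) => //; try lra.
  by rewrite addr_gt0.
have tau_t0 : tau - t0 = t by rewrite /tau addrK.
have dtau : delta <= tau by lra.
have t0tau : t0 <= tau by lra.
apply: linear_bound_unit_ball; first by apply: (sg_linear sgS); lra.
move=> x x1.
have sing := singular_increment A B T S M K genA genAB M1 K1 TM SK T_dom domAB
  tau x delta G beta G0 beta0 beta1 delta0 dtau
  (fun s s0 sd => BT s x s0 ltac:(lra) x1).
have reg := regular_increment A B T S M K genA genAB M1 K1 TM SK T_dom domAB
  tau x delta t0 (1 / (4 * t0)) delta0 delta_t0 t0tau.
have {}reg := reg (fun s r ds _ tr => lateSBT s r x x1 ds ltac:(lra))
  ltac:(by rewrite divr_ge0 // mulr_ge0 // ltW).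
have eps_t0 : 1 / (4 * t0) * (t0 - delta) <= 1 / 4.
  have -> : 1 / 4 = 1 / (4 * t0) * t0 by field; rewrite gt_eqF.
  by rewrite ler_wpM2l ?divr_ge0 ?mulr_ge0 ?(ltW t00) //; lra.
rewrite tau_t0 in reg.
have b0 : rnorm (S t (T t0 x)) <= 1 / 4.
  exact: le_trans (SK _ _ (ltW t_gt0)) (Tt0 x x1).
have := rnorm_distD (S t (T t0 x)) (S tau x) 0; rewrite !subr0.
have := rnorm_distD (S (tau - delta) (T delta x)) (S tau x) (S t (T t0 x)).
rewrite rnorm_distC in sing; rewrite rnorm_distC in reg.
rewrite -/D in sing; lra.
Qed.
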